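(* Let $M=\Sigma(a_1,\dots,a_n)$, $n\ge3$, be a Brieskorn--Hamm rational homology sphere, where $(a_1,\dots,a_n)$ has one of the following forms: (i) $(a_1,\dots,a_n)=(mp_1,mp_2,p_3,\dots,p_n)$, where $m\ge 1$, the $p_i$ are pairwise relatively prime positive integers and $\gcd(m,p_i)=1$ for $i\ge3$; here put $\alpha_i:=p_i$ for all $i$; (ii) $(a_1,\dots,a_n)=(2^cp_1,2p_2,2p_3,p_4,\dots,p_n)$, where $c\ge1$ and the $p_i$ are odd, pairwise relatively prime positive integers; here put $\alpha_1:=2^{c-1}p_1$ and $\alpha_i:=p_i$ for $i\ge2$. Assume $\alpha_i\ge2$ for all $i$. Then the minimal set of generators of the numerical semigroup $\mathcal{S}_M$ is, respectively: in case (i): $\alpha_2\alpha_3\cdots\alpha_n$, $\ \alpha_1\alpha_3\cdots\alpha_n$, and $m\cdot\alpha_1\cdots\alpha_{i-1}\alpha_{i+1}\cdots\alpha_n$ for every $3\le i\le n$; in case (ii): $\alpha_1\cdots\alpha_{i-1}\alpha_{i+1}\cdots\alpha_n$ for $i\in\{1,2,3\}$, and $2\cdot\alpha_1\cdots\alpha_{i-1}\alpha_{i+1}\cdots\alpha_n$ for $4\le i\le n$.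
   Context: For integers $a_i\ge2$ ($1\le i\le n$, $n\ge 3$), $\Sigma(a_1,\dots,a_n)$ is the link of the isolated complete intersection surface singularity $\{z\in\mathbb{C}^n : c_{j1}z_1^{a_1}+\dots+c_{jn}z_n^{a_n}=0,\ 1\le j\le n-2\}$ at the origin, with generic coefficients $c_{ji}$. It is a Seifert 3-manifold whose normalized Seifert invariants are of the form $(-b_0,g;\ (\alpha_i,\omega_i)\text{ repeated } s_i \text{ times},\ i=1,\dots,n)$ with $0<\omega_i<\alpha_i$, $\gcd(\alpha_i,\omega_i)=1$. It is a rational homology sphere (equivalently $g=0$) exactly when, up to permutation, $(a_1,\dots,a_n)$ has form (i) or (ii) of the claim, and in these cases the invariants are as follows. In both cases $\omega_i$ is determined by $\omega_iq_i\equiv-1 \pmod{\alpha_i}$ with $q_i:=\mathrm{lcm}(a_1,\dots,a_n)/a_i$. In case (i): $s_1=s_2=1$, $s_i=m$ for $i\ge3$, and $b_0$ is determined by $\alpha_1\cdots\alpha_n\big(b_0-\sum_{i=1}^n s_i\omega_i/\alpha_i\big)=1$. In case (ii): $s_1=s_2=s_3=2$, $s_i=4$ for $i\ge4$, and $b_0$ is determined by $\alpha_1\cdots\alpha_n\big(b_0-\sum_{i=1}^n s_i\omega_i/\alpha_i\big)=2$. The semigroup of $M$ is $\mathcal{S}_M:=\{\ell\in\mathbb{Z}: N(\ell)\ge0\}$, where $N(\ell):=b_0\ell-\sum_{i=1}^n s_i\lceil \ell\omega_i/\alpha_i\rceil$; it is a numerical semigroup contained in $\mathbb{Z}_{\ge0}$.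 *)

(* Defs.v *)
From mathcomp Require Import all_boot all_order all_algebra.
From mathcomp Require Import classical_sets.

Set Implicit Arguments.
Unset Strict Implicit.
Unset Printing Implicit Defensive.
Import Order.TTheory GRing.Theory Num.Theory.
Local Open Scope classical_set_scope.
Local Open Scope ring_scope.

(* Seifert invariants (-b0, g; (alpha_i, omega_i) repeated s_i times).
   Indices run over 0, ..., n-1, so the usual condition i >= 3 reads (2 <= i)%N. *)
Record seifert (n : nat) := Seifert {
  cent  : int;  (* b0, the opposite of the central Euler number *)
  genus : nat;
  alpha : 'I_n -> nat;
  omega : 'I_n -> nat;
  mult  : 'I_n -> nat  (* s_i *)
}.

Definition normalized (n : nat) (M : seifert n) : Prop :=
  forall i, [/\ (0 < omega M i)%N, (omega M i < alpha M i)%N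
              & coprime (alpha M i) (omega M i)].

Definition minus_euler (n : nat) (M : seifert n) : rat :=
  (cent M)%:~R
  - \sum_(i < n) (mult M i * omega M i)%:R / (alpha M i)%:R.

Definition Nfun (n : nat) (M : seifert n) (l : int) : int :=
  cent M * l
  - \sum_(i < n) (mult M i)%:Z *
      Num.ceil ((l * (omega M i)%:Z)%:~R / (alpha M i)%:R : rat).

Definition semigroup (n : nat) (M : seifert n) : set int :=
  [set l | 0 <= Nfun M l].

Definition pairwise_coprime (n : nat) (p : 'I_n -> nat) : Prop :=
  forall i j, i != j -> coprime (p i) (p j).

Definition form_i (n : nat) (a : 'I_n -> nat) (m : nat) (p : 'I_n -> nat) :
    Prop :=
  [/\ (1 <= m)%N,
      forall i, (0 < p i)%N,
      pairwise_coprime p,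
      forall i : 'I_n, (2 <= i)%N -> coprime m (p i)
    & forall i : 'I_n, a i = if (i < 2)%N then (m * p i)%N else p i].

Definition form_ii (n : nat) (a : 'I_n -> nat) (c : nat) (p : 'I_n -> nat) :
    Prop :=
  [/\ (1 <= c)%N,
      forall i, odd (p i),
      pairwise_coprime p
    & forall i : 'I_n, a i = if (i == 0 :> nat) then (2 ^ c * p i)%N
                             else if (i < 3)%N then (2 * p i)%N
                             else p i].

Definition lcm_quotient (n : nat) (a : 'I_n -> nat) (i : 'I_n) : nat :=
  ((\big[lcmn/1]_(j < n) a j) %/ a i)%N.

Definition omega_spec (n : nat) (a : 'I_n -> nat) (M : seifert n) : Prop :=
  forall i, ((omega M i)%:Z * (lcm_quotient a i)%:Z = -1
               %[mod (alpha M i)%:Z])%Z.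

(* M is the collection of normalized Seifert invariants of the rational
   homology sphere Sigma(a_1, ..., a_n), for a of the first, resp. second,
   form.  The equations below determine M uniquely when all alpha_i >= 2. *)
Definition link_i (n : nat) (a : 'I_n -> nat) (m : nat) (p : 'I_n -> nat)
    (M : seifert n) : Prop :=
  [/\ form_i a m p,
      genus M = 0%N /\ normalized M,
      forall i : 'I_n, alpha M i = p i
                    /\ mult M i = if (i < 2)%N then 1%N else m,
      omega_spec a M
    & (\prod_(i < n) alpha M i)%N%:R * minus_euler M = 1].

Definition link_ii (n : nat) (a : 'I_n -> nat) (c : nat) (p : 'I_n -> nat)
    (M : seifert n) : Prop :=
  [/\ form_ii a c p,
      genus M = 0%N /\ normalized M,
      forall i : 'I_n,
           alpha M i = (if (i == 0 :> nat) then 2 ^ c.-1 * p i else p i)%N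
        /\ mult M i = if (i < 3)%N then 2%N else 4%N,
      omega_spec a M
    & (\prod_(i < n) alpha M i)%N%:R * minus_euler M = 2].

Definition prod_others (n : nat) (f : 'I_n -> nat) (i : 'I_n) : nat :=
  (\prod_(j < n | j != i) f j)%N.

(* Additive submonoid: the empty sum puts 0 in [generated G]. *)
Definition generated (G : set int) : set int :=
  [set x | exists2 s : seq int, (forall y, y \in s -> G y)
                              & x = \sum_(y <- s) y].

Definition minimal_generators (S G : set int) : Prop :=
  generated G = S
  /\ forall H : set int, H `<=` G -> generated H = S -> H = G.

Definition the_minimal_generators (S G : set int) : Prop :=
  forall H : set int, minimal_generators S H <-> H = G.

(* Main.v *)
Require Import Defs.
From mathcomp Require Import all_boot all_order all_algebra.
From mathcomp Require Import classical_sets.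
From mathcomp Require Import ring.
Set Implicit Arguments.
Unset Strict Implicit.
Unset Printing Implicit Defensive.
Import Order.TTheory GRing.Theory Num.Theory.
Local Open Scope classical_set_scope.
Local Open Scope ring_scope.

(** Write P for the product of the alpha_i, P_i = P / alpha_i, and r_i(l) for
    the remainder of - l omega_i modulo alpha_i.  In both families the
    multiplicities have the form s_i = e t_i, where e is P times the opposite
    of the Euler number (e = 1, resp. 2), and the claimed generators are
    g_i = t_i P_i.  Rounding up l omega_i / alpha_i adds r_i(l) / alpha_i to
    it, so the definition of N turns into the identity of [prod_Nfun]

      P N(l) = e (l - sum_i g_i r_i(l)).

    So l is in the semigroup iff sum_i g_i r_i(l) <= l ([semigroupP]), and
    everything can be read off from the remainders.

    - The g_i generate.  At the first index, t_0 = 1 and P_0 is prime to e.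
      For l in the semigroup, l - sum_i g_i r_i(l) is nonnegative; and P_0
      divides P N(l), hence it divides this difference, as e is cancelled by
      coprimality.  So l = sum_i g_i r_i(l) + q g_0 with q >= 0
      ([semigroup_generated]).

    - The g_i belong to the semigroup, with equality in the criterion.  The
      least common multiple of the a_i is such that g_i is exactly the
      quotient q_i in the congruence defining omega_i ([lcm_quotientE]); hence
      omega_i g_i = -1 modulo alpha_i and r_i(g_i) = 1, while alpha_i divides
      the other g_j ([residue_gen]).

    - No g_j is redundant.  An element l of the semigroup that alpha_j does not
      divide has r_j(l) >= 1, hence l >= g_j: so g_j is the smallest such
      element ([gen_le]).  A sum of elements of the semigroup equal to g_j has
      a term not divisible by alpha_j; this term is at least g_j, so it is g_j.

    A generating set all of whose members are irreducible in this sense is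
    contained in every generating set, and so is the only minimal one
    ([the_minimal_generators_irreducible]). *)

(** * Submonoids of the integers *)

Lemma generated_sub (G : set int) : G `<=` generated G.
Proof.
move=> x Gx; exists [:: x]; last by rewrite big_seq1.
by move=> y; rewrite inE => /eqP->.
Qed.

Lemma generated0 (G : set int) : generated G 0.
Proof. by exists [::]; rewrite ?big_nil. Qed.

Lemma generatedD (G : set int) (x y : int) :
  generated G x -> generated G y -> generated G (x + y).
Proof.
move=> [s Gs ->] [t Gt ->]; exists (s ++ t); last by rewrite big_cat.
by move=> z; rewrite mem_cat => /orP[/Gs|/Gt].
Qed.

Lemma generatedM (G : set int) (x k : int) :
  0 <= k -> generated G x -> generated G (x * k).
Proof.
case: k => // k _ Gx; elim: k => [|k IH].
  by rewrite mulr0; exact: generated0.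
by rewrite intS mulrDr mulr1; apply: generatedD.
Qed.

Lemma generated_sum (G : set int) (I : Type) (s : seq I) (f : I -> int) :
  (forall i, generated G (f i)) -> generated G (\sum_(i <- s) f i).
Proof.
move=> Gf; elim/big_rec: _ => [|i x _]; first exact: generated0.
exact: generatedD.
Qed.

Lemma generated_min (G S : set int) :
  S 0 -> (forall x y, S x -> S y -> S (x + y)) -> G `<=` S ->
  generated G `<=` S.
Proof.
move=> S0 SD GS x [s Gs ->].
by rewrite big_seq; elim/big_rec: _ => // y z /Gs /GS; exact: SD.
Qed.

(** Irreducibility forces G into every subset that generates S, since an
    expression of g in G as a sum has to contain g itself. *)
Lemma the_minimal_generators_irreducible (S G : set int) :
  generated G = S ->
  (forall s : seq int, (forall y, y \in s -> S y) ->
     G (\sum_(y <- s) y) -> \sum_(y <- s) y \in s) ->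
  the_minimal_generators S G.
Proof.
move=> genG irr.
have sub_gen (H : set int) : generated H = S -> G `<=` H.
  move=> genH g Gg; have [s Hs gE] : generated H g.
    by rewrite genH -genG; exact: generated_sub.
  apply: (Hs); rewrite gE; apply: irr; last by rewrite -gE.
  by move=> y ys; rewrite -genH; apply: generated_sub; exact: Hs.
move=> H; split=> [[genH minH]|->].
  by rewrite -(minH G) //; exact: sub_gen.
split=> // K KG genK; apply/seteqP; split=> //; exact: sub_gen.
Qed.

(** * Remainders and the function N *)

Lemma ceil_divz (x : int) (d : nat) : (0 < d)%N ->
  Num.ceil (x%:~R / d%:R : rat) = - ((- x) %/ d%:Z)%Z.
Proof.
move=> d_gt0; have dz : 0 < d%:Z by [].
apply: ceil_def; rewrite ltr_pdivlMr ?ltr0n // ler_pdivrMr ?ltr0n //.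
rewrite -[d%:R]/(d%:Z%:~R) -!intrM ltr_int ler_int; apply/andP; split.
  by have := ltz_ceil (- x) dz; rewrite ltrNl -mulNr opprD.
by rewrite mulNr lerNr lez_floor // gt_eqF.
Qed.

Lemma modzD_le (x y d : int) : 0 < d ->
  ((x + y) %% d)%Z <= (x %% d)%Z + (y %% d)%Z.
Proof.
move=> d_gt0; rewrite -modzDm /modz lerBlDr -lerBlDl subrr.
by rewrite mulr_ge0 ?(ltW d_gt0) // divz_ge0 // addr_ge0 // modz_ge0 // gt_eqF.
Qed.

(** The rounding defect of l omega_i / alpha_i, in units of 1 / alpha_i. *)
Definition residue (n : nat) (M : seifert n) (l : int) (i : 'I_n) : int :=
  ((- (l * (omega M i)%:Z)) %% (alpha M i)%:Z)%Z.

Definition gen (n : nat) (M : seifert n) (t : 'I_n -> nat) (i : 'I_n) : nat :=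
  (t i * prod_others (alpha M) i)%N.

(** The common shape of the two families: e = 1 and t_i in {1, m} for
    [link_i], e = 2 and t_i in {1, 2} for [link_ii].  The congruence on omega
    is stated against the prospective generators, which spares the argument
    any mention of the a_i. *)
Record weighted_link (n : nat) (M : seifert n) (e : nat) (t : 'I_n -> nat) :
    Prop := WeightedLink {
  wl_e_gt0 : (0 < e)%N;
  wl_alpha : forall i, (2 <= alpha M i)%N;
  wl_mult  : forall i, mult M i = (e * t i)%N;
  wl_omega : forall i,
    ((omega M i)%:Z * (gen M t i)%:Z = -1 %[mod (alpha M i)%:Z])%Z;
  wl_euler : (\prod_(i < n) alpha M i)%N%:R * minus_euler M = e%:R
}.

Lemma mul_prod_others (n : nat) (f : 'I_n -> nat) (i : 'I_n) :
  (f i * prod_others f i)%N = (\prod_(j < n) f j)%N.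
Proof. by rewrite (bigD1 i). Qed.

Lemma dvd_prod_others (n : nat) (f : 'I_n -> nat) (i j : 'I_n) :
  i != j -> (f i %| prod_others f j)%N.
Proof. by move=> ij; rewrite /prod_others (bigD1 i) //= dvdn_mulr. Qed.

Lemma residue_ge0 (n : nat) (M : seifert n) (l : int) (i : 'I_n) :
  (2 <= alpha M i)%N -> 0 <= residue M l i.
Proof. by move=> a2; rewrite modz_ge0 // gt_eqF //; case: (alpha M i) a2. Qed.

(** Clearing denominators in N: the defining equation of b0 collapses the terms
    linear in l to e l, and the rounding defects remain. *)
Lemma prod_Nfun (n : nat) (M : seifert n) (e : nat) (t : 'I_n -> nat)
    (l : int) :
  weighted_link M e t ->
  (\prod_(i < n) alpha M i)%N%:Z * Nfun M l =
  e%:Z * (l - \sum_(i < n) (gen M t i)%:Z * residue M l i).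
Proof.
move=> W; set P := (\prod_(i < n) alpha M i)%N.
have a_gt0 i : (0 < alpha M i)%N by apply: ltn_trans (wl_alpha W i).
have eulerZ : P%:Z * cent M
    - \sum_(i < n) (e * gen M t i * omega M i)%N%:Z = e%:Z.
  apply/eqP; rewrite -(eqr_int rat); apply/eqP.
  rewrite -[RHS](wl_euler W) /minus_euler rmorphB rmorph_sum rmorphM /= mulrBr.
  congr (_ - _); rewrite mulr_sumr; apply: eq_bigr => i _.
  have a_neq0 : (alpha M i)%:R != 0 :> rat by rewrite pnatr_eq0 -lt0n.
  rewrite -/P -[P in RHS](mul_prod_others (alpha M) i) (wl_mult W).
  rewrite -[_%:~R in LHS]/(_%:R) /gen !natrM; field.
  exact: a_neq0.
rewrite /Nfun mulrBr mulrA mulr_sumr.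
have -> : \sum_(i < n) P%:Z * ((mult M i)%:Z * Num.ceil
      ((l * (omega M i)%:Z)%:~R / (alpha M i)%:R : rat)) =
    l * (\sum_(i < n) (e * gen M t i * omega M i)%N%:Z)
    + e%:Z * \sum_(i < n) (gen M t i)%:Z * residue M l i.
  rewrite !mulr_sumr -big_split; apply: eq_bigr => i _ /=.
  rewrite ceil_divz // /residue /modz.
  rewrite -[P](mul_prod_others (alpha M) i) (wl_mult W) /gen !PoszM.
  ring.
have -> : P%:Z * cent M
    = e%:Z + \sum_(i < n) (e * gen M t i * omega M i)%N%:Z.
  by rewrite -eulerZ subrK.
ring.
Qed.

(** * The semigroup *)

Lemma semigroupP (n : nat) (M : seifert n) (e : nat) (t : 'I_n -> nat)
    (l : int) :
  weighted_link M e t ->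
  semigroup M l <-> \sum_(i < n) (gen M t i)%:Z * residue M l i <= l.
Proof.
move=> W; have P_gt0 : 0 < (\prod_(i < n) alpha M i)%N%:Z.
  by apply: prodn_gt0 => i; apply: ltn_trans (wl_alpha W i).
rewrite /semigroup /= -(pmulr_rge0 _ P_gt0) (prod_Nfun l W).
by rewrite pmulr_rge0 ?subr_ge0 // [0 < _](wl_e_gt0 W).
Qed.

Lemma gen_residue_ge0 (n : nat) (M : seifert n) (e : nat) (t : 'I_n -> nat)
    (l : int) (i : 'I_n) :
  weighted_link M e t -> 0 <= (gen M t i)%:Z * residue M l i.
Proof. by move=> W; rewrite mulr_ge0 // residue_ge0 // (wl_alpha W). Qed.

Lemma semigroup_ge0 (n : nat) (M : seifert n) (e : nat) (t : 'I_n -> nat)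
    (l : int) :
  weighted_link M e t -> semigroup M l -> 0 <= l.
Proof.
move=> W /(semigroupP l W); apply: le_trans.
by apply: sumr_ge0 => i _; exact: gen_residue_ge0 W.
Qed.

Lemma semigroup0 (n : nat) (M : seifert n) (e : nat) (t : 'I_n -> nat) :
  weighted_link M e t -> semigroup M 0.
Proof.
move=> W; apply/(semigroupP _ W); rewrite big1 // => i _.
by rewrite /residue mul0r oppr0 mod0z mulr0.
Qed.

(** Taking remainders is subadditive, so the left-hand side of [semigroupP]
    is too. *)
Lemma semigroupD (n : nat) (M : seifert n) (e : nat) (t : 'I_n -> nat)
    (x y : int) :
  weighted_link M e t -> semigroup M x -> semigroup M y -> semigroup M (x + y).
Proof.
move=> W /(semigroupP x W) Sx /(semigroupP y W) Sy; apply/(semigroupP _ W).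
apply: le_trans (lerD Sx Sy); rewrite -big_split; apply: ler_sum => i _ /=.
rewrite -mulrDr ler_wpM2l // /residue mulrDl opprD modzD_le //.
exact: ltn_trans (wl_alpha W i).
Qed.

Lemma residue_gen (n : nat) (M : seifert n) (e : nat) (t : 'I_n -> nat)
    (i j : 'I_n) :
  weighted_link M e t -> residue M (gen M t j)%:Z i = (i == j)%:Z.
Proof.
move=> W; rewrite /residue; have [->|ij] := eqVneq i j.
  rewrite -modzNm mulrC (wl_omega W) modzNm opprK modz_small //=.
  exact: (wl_alpha W j).
apply/dvdz_mod0P; rewrite rpredN dvdz_mulr // /gen PoszM dvdz_mull //.
exact: dvd_prod_others.
Qed.

Lemma semigroup_gen (n : nat) (M : seifert n) (e : nat) (t : 'I_n -> nat)
    (j : 'I_n) :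
  weighted_link M e t -> semigroup M (gen M t j)%:Z.
Proof.
move=> W; apply/(semigroupP _ W); rewrite (bigD1 j) //= big1 => [|i ij].
  by rewrite (residue_gen j j W) eqxx mulr1 addr0.
by rewrite (residue_gen i j W) (negPf ij) mulr0.
Qed.

(** The congruence makes omega_j a unit modulo alpha_j, so if alpha_j does not
    divide l then r_j(l) >= 1, and the term g_j r_j(l) of [semigroupP] already
    reaches g_j. *)
Lemma gen_le (n : nat) (M : seifert n) (e : nat) (t : 'I_n -> nat)
    (j : 'I_n) (l : int) :
  weighted_link M e t -> semigroup M l -> ~~ ((alpha M j)%:Z %| l)%Z ->
  (gen M t j)%:Z <= l.
Proof.
move=> W /(semigroupP l W) Sl ndvd.
apply: le_trans Sl; rewrite (bigD1 j) //=.
rewrite ler_wpDr ?sumr_ge0 // => [i _|]; first exact: gen_residue_ge0 W.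
rewrite ler_peMr // -gtz0_ge1 lt_def residue_ge0 ?(wl_alpha W) // andbT.
apply: contra ndvd => /eqP/dvdz_mod0P; rewrite rpredN => dvd_lw.
have /eqP := wl_omega W j; rewrite eqz_mod_dvd opprK => dvd_wg.
(* multiplying alpha_j | l omega_j by g_j, the inverse of - omega_j *)
have lE : l = l * ((omega M j)%:Z * (gen M t j)%:Z + 1)
    - l * (omega M j)%:Z * (gen M t j)%:Z by ring.
by rewrite lE; apply: rpredB; [exact: dvdz_mull|exact: dvdz_mulr].
Qed.

Lemma gen_dvd (n : nat) (M : seifert n) (e : nat) (t : 'I_n -> nat) (j : 'I_n) :
  weighted_link M e t -> ~~ ((alpha M j)%:Z %| (gen M t j)%:Z)%Z.
Proof.
move=> W; apply/negP => dvd_g.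
have /eqP := wl_omega W j; rewrite eqz_mod_dvd opprK.
rewrite rpredDl ?dvdz_mull // dvdz1.
by case: (alpha M j) (wl_alpha W j) => [|[]].
Qed.

(** An element is recovered from its remainders up to a multiple of the
    generator g_i0 = P_i0; coprimality with e is what allows dividing the
    identity of [prod_Nfun] by e. *)
Lemma semigroup_generated (n : nat) (M : seifert n) (e : nat)
    (t : 'I_n -> nat) (i0 : 'I_n) :
  weighted_link M e t -> t i0 = 1%N -> coprime (prod_others (alpha M) i0) e ->
  semigroup M = generated [set x : int | exists i : 'I_n, x = (gen M t i)%:Z].
Proof.
move=> W t0 cop; set G := [set x | _].
have Ggen i : G (gen M t i)%:Z by exists i.
apply/seteqP; split; last first.
  apply: generated_min; first exact: semigroup0 W.
    by move=> x y; exact: semigroupD W.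
  by move=> _ [i ->]; exact: semigroup_gen W.
move=> l Sl; set D := \sum_(i < n) (gen M t i)%:Z * residue M l i.
have : ((gen M t i0)%:Z %| l - D)%Z.
  rewrite /gen t0 mul1n -(@Gauss_dvdzr _ e) // -(prod_Nfun l W) dvdz_mulr //.
  by rewrite -(mul_prod_others _ i0) PoszM dvdz_mull.
case/dvdzP => q lE; rewrite -(subrK D l) lE addrC.
apply: generatedD.
  apply: generated_sum => i; apply: generatedM; last exact: generated_sub.
  by rewrite residue_ge0 // (wl_alpha W).
rewrite mulrC; apply: generatedM; last exact: generated_sub.
have g0_gt0 : 0 < (gen M t i0)%:Z.
  rewrite /gen t0 mul1n; apply: prodn_gt0 => i.
  exact: ltn_trans (wl_alpha W i).
by rewrite -(pmulr_lge0 _ g0_gt0) -lE subr_ge0; apply/(semigroupP l W).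
Qed.

(** The generators are irreducible because each g_j is the smallest element of
    the semigroup not divisible by alpha_j. *)
Lemma weighted_link_generators (n : nat) (M : seifert n) (e : nat)
    (t : 'I_n -> nat) (i0 : 'I_n) :
  weighted_link M e t -> t i0 = 1%N -> coprime (prod_others (alpha M) i0) e ->
  the_minimal_generators (semigroup M)
    [set x : int | exists i : 'I_n, x = (gen M t i)%:Z].
Proof.
move=> W t0 cop; apply: the_minimal_generators_irreducible.
  by rewrite -(semigroup_generated W t0 cop).
move=> s Ss [j sE].
have /hasP[y ys ndvd] : has (fun y => ~~ ((alpha M j)%:Z %| y)%Z) s.
  rewrite has_predC; apply: contra (gen_dvd j W) => /allP dvd_s.
  by rewrite -sE big_seq; apply: rpred_sum => y /dvd_s.
have : \sum_(z <- s) z = y.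
  apply/le_anti/andP; split; rewrite ?sE; last first.
    rewrite -sE (big_rem y) //= lerDl big_seq sumr_ge0 // => z /mem_rem zs.
    exact: semigroup_ge0 W (Ss z zs).
  exact: gen_le W (Ss y ys) ndvd.
by move=> ->.
Qed.

(** * The two families *)

Lemma prod_dvd_coprime (n : nat) (f : 'I_n -> nat) (L : nat) :
  pairwise_coprime f -> (forall i, (f i %| L)%N) ->
  (\prod_(i < n) f i %| L)%N.
Proof.
move=> cop dvdL.
suff: forall s : seq 'I_n, uniq s -> (\prod_(i <- s) f i %| L)%N.
  by apply; rewrite index_enum_uniq.
elim=> [_|i s IH /= /andP[is_ us]]; first by rewrite big_nil dvd1n.
rewrite big_cons Gauss_dvd ?dvdL ?IH // big_seq.
elim/big_rec: _ => [|j m js cim]; first exact: coprimen1.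
rewrite coprimeMr cim andbT cop //.
by apply: contraNneq is_ => ->.
Qed.

(** The least common multiple is k times the product of the f_i: a common
    multiple is k L', and each f_i divides L', either because k f_i is one of
    the a_i or because k is prime to f_i.  With i0 in S, the factor k does
    occur. *)
Lemma lcm_quotientE (n : nat) (a f : 'I_n -> nat) (k : nat) (S : pred 'I_n)
    (i0 : 'I_n) :
  (0 < k)%N -> (forall i, (0 < f i)%N) -> pairwise_coprime f ->
  (forall i, ~~ S i -> coprime k (f i)) -> S i0 ->
  (forall i, a i = if S i then (k * f i)%N else f i) ->
  forall i, lcm_quotient a i = ((if S i then 1 else k) * prod_others f i)%N.
Proof.
move=> k_gt0 f_gt0 copf copk S0 aE i.
have lcmE : (\big[lcmn/1]_(j < n) a j)%N = (k * \prod_(j < n) f j)%N.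
  apply/eqP; rewrite eqn_dvd; apply/andP; split.
    apply/dvdn_biglcmP => j _; rewrite aE -(mul_prod_others f j).
    case: ifP => _; first by rewrite mulnA dvdn_mulr.
    by rewrite dvdn_mull ?dvdn_mulr.
  set L := (\big[lcmn/_]_(_ < _) _)%N.
  have aL j : (a j %| L)%N by exact: (@biglcmn_sup _ j).
  have /dvdnP[L' LE] : (k %| L)%N.
    by apply: dvdn_trans (aL i0); rewrite aE S0 dvdn_mulr.
  rewrite LE mulnC dvdn_pmul2r //; apply: prod_dvd_coprime => // j.
  have := aL j; rewrite aE LE; have [Sj|nSj] := boolP (S j).
    by rewrite mulnC dvdn_pmul2r.
  by rewrite Gauss_dvdl // coprime_sym copk.
rewrite /lcm_quotient lcmE -(mul_prod_others f i) aE.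
case: ifP => _; first by rewrite mulnA mulKn ?mul1n // muln_gt0 k_gt0 f_gt0.
by rewrite mulnCA mulKn.
Qed.

Lemma prod_others_coprime (n : nat) (f : 'I_n -> nat) (i : 'I_n) (e : nat) :
  (forall j, j != i -> coprime (f j) e) -> coprime (prod_others f i) e.
Proof.
move=> cop; rewrite /prod_others; elim/big_rec: _ => [|j x ji cx].
  exact: coprime1n.
by rewrite coprimeMl cop.
Qed.

Theorem theorem8p2p2 (n : nat) (hn : (3 <= n)%N) (a : 'I_n -> nat)
    (ha : forall i, (2 <= a i)%N) (M : seifert n)
    (halpha : forall i, (2 <= alpha M i)%N) :
  (forall (m : nat) (p : 'I_n -> nat), link_i a m p M ->
     the_minimal_generators (semigroup M)
       [set x : int | exists i : 'I_n,
          x = ((if (i < 2)%N then 1 else m) * prod_others (alpha M) i)%N%:Z])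
  /\
  (forall (c : nat) (p : 'I_n -> nat), link_ii a c p M ->
     the_minimal_generators (semigroup M)
       [set x : int | exists i : 'I_n,
          x = ((if (i < 3)%N then 1 else 2) * prod_others (alpha M) i)%N%:Z]).
Proof.
have alpha_gt0 i : (0 < alpha M i)%N by apply: ltn_trans (halpha i).
pose i0 : 'I_n := Ordinal (ltn_trans (isT : (0 < 2)%N) hn).
split.
- move=> m p [[m_gt0 _ cop_p cop_m aE] _ aM omegaM eulerM].
  have alphaE i : alpha M i = p i by case: (aM i).
  apply: (@weighted_link_generators n M 1
    (fun i : 'I_n => if (i < 2)%N then 1 else m)%N i0); rewrite ?coprimen1 //.
  split=> // i.
  + by rewrite mul1n; case: (aM i).
  + rewrite -(omegaM i) /gen.
    rewrite (@lcm_quotientE n a (alpha M) m (fun i : 'I_n => i < 2)%N i0) //.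
    * by move=> j k jk; rewrite !alphaE cop_p.
    * by move=> j; rewrite -leqNgt alphaE; exact: cop_m.
    * by move=> j; rewrite alphaE aE.
- move=> c p [[c_gt0 odd_p cop_p aE] _ aM omegaM eulerM].
  (* the common factor is k = 2: a_1 = 2^c p_1 is twice alpha_1 = 2^(c-1) p_1 *)
  have alphaE i : alpha M i = (if i == i0 then 2 ^ c.-1 * p i else p i)%N.
    by case: (aM i).
  have cop2 i : coprime 2 (p i) by rewrite coprime2n.
  apply: (@weighted_link_generators n M 2
    (fun i : 'I_n => if (i < 3)%N then 1 else 2)%N i0) => //; last first.
    apply: prod_others_coprime => j ji0.
    by rewrite alphaE (negPf ji0) coprime_sym.
  split=> // i.
  + by case: (aM i) => _ ->; case: ifP.
  + rewrite -(omegaM i) /gen.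
    rewrite (@lcm_quotientE n a (alpha M) 2 (fun i : 'I_n => i < 3)%N i0) //.
    * move=> j k jk; rewrite !alphaE.
      have [j0|_] := eqVneq j i0; have [k0|_] := eqVneq k i0.
      - by rewrite j0 k0 eqxx in jk.
      - by rewrite coprimeMl cop_p // coprimeXl.
      - by rewrite coprimeMr cop_p // coprime_sym coprimeXl.
      - exact: cop_p.
    * move=> j; rewrite -leqNgt alphaE => j3.
      by have [j0|_] := eqVneq j i0; [rewrite j0 in j3|exact: cop2].
    * move=> j; rewrite alphaE aE -[j == 0 :> nat]/(j == i0).
      have [->|_] := eqVneq j i0; last by [].
      by rewrite /= mulnA -expnS prednK.
Qed.
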